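(* With probability one there exists $n_0$ such that for every $n\ge n_0$ the function $\mathbb R^2\ni(\alpha',\theta')\mapsto Q_n(\mathbf Y_n;\alpha',\theta')$ has a unique global minimizer $(\tilde\alpha_n,\tilde\theta_n)$, given by $$\tilde\alpha_n=\frac{\sum_{k=1,k\neq s}^n(Y_k-\mu_\varepsilon)Y_{k-1}}{\sum_{k=1,k\neq s}^nY_{k-1}^2},\qquad \tilde\theta_n=Y_s-\tilde\alpha_nY_{s-1}-\mu_\varepsilon .$$ Moreover, for every $(\alpha,\theta)\in(0,1)\times\mathbb N$, almost surely $\tilde\alpha_n\to\alpha$ and $\tilde\theta_n\to Y_s-\alpha Y_{s-1}-\mu_\varepsilon$.
   Context: INAR(1) with an innovational outlier: Let $\alpha\in(0,1)$. Let $(\varepsilon_k)_{k\in\mathbb N}$ be i.i.d. non-negative integer-valued random variables with $\mathbb E\varepsilon_1^2<\infty$ and $\mathbb P(\varepsilon_1\ne 0)>0$; write $\mu_\varepsilon=\mathbb E\varepsilon_1$ (assumed known). For each $k\in\mathbb N$ let $(\xi_{k,j})_{j\in\mathbb N}$ be i.i.d. Bernoulli random variables with mean $\alpha$, these sequences being mutually independent and independent of $(\varepsilon_k)$. Fix a known time $s\in\mathbb N$ and size $\theta\in\mathbb N$. Let $Y_0$ be a non-negative integer-valued random variable with $\mathbb E Y_0^2<\infty$, independent of all $\xi_{k,j},\varepsilon_k$, and set $Y_k=\sum_{j=1}^{Y_{k-1}}\xi_{k,j}+\varepsilon_k+\delta_{k,s}\theta$, $k\in\mathbb N$. Write $\mathbf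 Y_n=(Y_0,\dots,Y_n)$, $\mathbf y_n=(y_0,\dots,y_n)$. For $n\ge s$, $$Q_n(\mathbf y_n;\alpha',\theta')=\sum_{\substack{k=1\\k\neq s}}^n(y_k-\alpha'y_{k-1}-\mu_\varepsilon)^2+(y_s-\alpha'y_{s-1}-\mu_\varepsilon-\theta')^2 .$$ *)

(* Defs.v *)
From HB Require Import structures.
From mathcomp Require Import all_boot all_order all_algebra.
From mathcomp Require Import all_classical all_reals all_analysis.
Set Implicit Arguments. Unset Strict Implicit. Unset Printing Implicit Defensive.
Import Order.TTheory GRing.Theory Num.Theory.
Import numFieldNormedType.Exports.
Local Open Scope classical_set_scope.
Local Open Scope ring_scope.

Section Defs.
Context {d : measure_display} {T : measurableType d} {R : realType}.

Definition mutually_independent_nat (P : probability T R) (I : eqType)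
  (S : pred I) (X : I -> T -> nat) : Prop :=
  (forall i v, S i -> measurable (X i @^-1` [set v])) /\
  (forall (l : seq I) (v : I -> nat), uniq l -> all S l ->
     P (\bigcap_(i in [set i | i \in l]) (X i @^-1` [set v i])) =
     (\prod_(i <- l) P (X i @^-1` [set v i]))%E).

(* Index set of all the driving variables: Y_0, eps_k (k >= 1), xi_{k,j} (k,j >= 1). *)
Definition inar_index := (unit + (nat + nat * nat))%type.

Definition inar_valid (i : inar_index) : bool :=
  match i with
  | inl _ => true
  | inr (inl k) => (0 < k)%N
  | inr (inr (k, j)) => (0 < k)%N && (0 < j)%N
  end.

Definition inar_family (Y0 : T -> nat) (eps : nat -> T -> nat)
  (xi : nat -> nat -> T -> nat) (i : inar_index) : T -> nat :=
  match i with
  | inl _ => Y0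
  | inr (inl k) => eps k
  | inr (inr (k, j)) => xi k j
  end.

Fixpoint inarY (Y0 : T -> nat) (eps : nat -> T -> nat)
  (xi : nat -> nat -> T -> nat) (s theta : nat) (n : nat) (t : T) : nat :=
  match n with
  | 0 => Y0 t
  | k.+1 => (\sum_(j < inarY Y0 eps xi s theta k t) xi k.+1 j.+1 t)
            + eps k.+1 t + (if k.+1 == s then theta else 0)
  end.

End Defs.

Definition Qn {R : realType} (mu : R) (s n : nat) (y : nat -> R) (a th : R) : R :=
  \sum_(1 <= k < n.+1 | k != s) (y k - a * y k.-1 - mu) ^+ 2
  + (y s - a * y s.-1 - mu - th) ^+ 2.

Definition alpha_tilde {R : realType} (mu : R) (s n : nat) (y : nat -> R) : R :=
  (\sum_(1 <= k < n.+1 | k != s) (y k - mu) * y k.-1) /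
  (\sum_(1 <= k < n.+1 | k != s) y k.-1 ^+ 2).

Definition theta_tilde {R : realType} (mu : R) (s n : nat) (y : nat -> R) : R :=
  y s - alpha_tilde mu s n y * y s.-1 - mu.

(* Main.v *)
Require Import Defs.
From HB Require Import structures.
From mathcomp Require Import all_boot all_order all_algebra.
From mathcomp Require Import all_classical all_reals all_analysis.
From mathcomp Require Import measurable_realfun ring lra.
Set Implicit Arguments.
Unset Strict Implicit.
Unset Printing Implicit Defensive.
Import Order.TTheory GRing.Theory Num.Theory.
Import numFieldNormedType.Exports.
Local Open Scope classical_set_scope.
Local Open Scope ring_scope.

(** Put [M_k = Y_k - alpha Y_{k-1} - mu - theta [k = s]], a martingale difference
    with conditional variance [alpha (1 - alpha) Y_{k-1} + sigma^2], and
    [D_n = \sum_{k <= n, k <> s} Y_{k-1}^2].  Then [alpha_tilde_n - alpha] equals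
    [\sum_{k <= n, k <> s} Y_{k-1} M_k / D_n].  Since [D_k] depends only on the past
    of [M_k] and [Y_{k-1} <= sqrt D_k], the conditional variances of the increments
    [Y_{k-1} M_k / D_k] are at most a constant times [Y_{k-1}^2 / D_k^(3/2)], whose
    sum telescopes to a deterministic bound.  Hence only second moments are needed
    for [\sum_k Y_{k-1} M_k / D_k] to converge almost surely, by Kolmogorov's maximal
    inequality.  As [eps_k > 0] infinitely often, [D_n] tends to infinity, and
    Kronecker's lemma gives [alpha_tilde_n -> alpha].  The excess of [Q_n] over its
    value at the estimators is a sum of two squares, the first weighted by [D_n]. *)

(** * Independence in countable families *)

Section countable_valued.
Context {d : measure_display} {T : measurableType d} {R : realType}.

Lemma measurable_preimage_countable {C : countType} (h : T -> C) (B : set C) :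
  (forall c, measurable (h @^-1` [set c])) -> measurable (h @^-1` B).
Proof.
move=> mh.
rewrite (_ : h @^-1` B = \bigcup_(c in B) (h @^-1` [set c])); last first.
  apply/seteqP; split => [t Bt|t [c Bc /= hc]]; last by rewrite /= hc.
  by exists (h t).
rewrite bigcup_mkcond; apply: countable_bigcupT_measurable.
  exact: countableP.
by move=> c; case: ifP => _.
Qed.

Lemma measurable_fun_countable {C : countType} {d'} {U : measurableType d'}
    (h : T -> C) (F : C -> U) (D : set T) : measurable D ->
  (forall c, measurable (h @^-1` [set c])) ->
  measurable_fun D (fun t => F (h t)).
Proof.
move=> mD mh _ B mB; apply: measurableI => //.
rewrite [X in measurable X](_ : _ = h @^-1` (F @^-1` B)) //.
exact: measurable_preimage_countable.
Qed.

Variable P : probability T R.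

Lemma ge0_integral_fibers (X : T -> nat) (A : set T) (f : T -> \bar R) :
  measurable A -> (forall v, measurable (X @^-1` [set v])) ->
  measurable_fun A f -> (forall t, 0 <= f t)%E ->
  (\int[P]_(t in A) f t =
   \sum_(v <oo) \int[P]_(t in A `&` X @^-1` [set v]) f t)%E.
Proof.
move=> mA mX mf f0.
have AE : A = \bigcup_v (A `&` X @^-1` [set v]).
  apply/seteqP; split => [t At|t [v _ []]] //.
  by exists (X t).
rewrite {1}AE ge0_integral_bigcup //.
- by move=> v; exact: measurableI.
- by rewrite -AE.
- by move=> i j _ _ [t [[_ /= ->] [_ /= ->]]].
Qed.

Lemma measure_fibers (X : T -> nat) (A : set T) :
  measurable A -> (forall v, measurable (X @^-1` [set v])) ->
  (P A = \sum_(v <oo) P (A `&` X @^-1` [set v]))%E.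
Proof.
move=> mA mX.
have AE : A = \bigcup_v (A `&` X @^-1` [set v]).
  apply/seteqP; split => [t At|t [v _ []]] //.
  by exists (X t).
rewrite {1}AE measure_bigcup //; last first.
- by move=> i j _ _ [t [[_ /= ->] [_ /= ->]]].
- by move=> v _; exact: measurableI.
by apply: eq_eseriesl => v; rewrite in_setT.
Qed.

(** This replaces conditional expectation: with [h] the history of the process, two integrands are
    compared where the whole past is fixed. Encoding [C] in [nat] by [pickle] makes the fibers a
    sequence. *)
Lemma eq_integral_fibers {C : countType} (h : T -> C) (f g : T -> \bar R) :
  (forall c, measurable (h @^-1` [set c])) ->
  measurable_fun setT f -> measurable_fun setT g ->
  (forall t, 0 <= f t)%E -> (forall t, 0 <= g t)%E ->
  (forall c, \int[P]_(t in h @^-1` [set c]) f t =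
             \int[P]_(t in h @^-1` [set c]) g t)%E ->
  (\int[P]_t f t = \int[P]_t g t)%E.
Proof.
move=> mh mf mg f0 g0 fg.
have mX v : measurable ((pickle \o h) @^-1` [set v]).
  exact: (@measurable_preimage_countable _ h [set c | pickle c = v]).
rewrite (@ge0_integral_fibers (pickle \o h)) // [RHS](@ge0_integral_fibers (pickle \o h)) //.
apply: eq_eseriesr => n _; rewrite setTI.
have [[t0 t0n]|H] := pselect (exists t, pickle (h t) = n).
  rewrite (_ : _ @^-1` _ = h @^-1` [set h t0]) //.
  by apply/seteqP; split => t /=; [rewrite -t0n => /(pcan_inj pickleK)|move=> ->].
rewrite (_ : _ @^-1` _ = set0) ?integral_set0 //.
by apply/seteqP; split => t //= tn; apply: H; exists t.
Qed.

End countable_valued.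

Lemma measure_nneseriesZl {d} {T : measurableType d} {R : realType}
    (P : probability T R) (A : set T) (f : nat -> \bar R) :
  measurable A -> (forall n, 0 <= f n)%E ->
  (P A * \sum_(n <oo) f n = \sum_(n <oo) P A * f n)%E.
Proof.
by move=> mA f0; rewrite -(fineK (fin_num_measure P A mA)) nneseriesZl.
Qed.

Section independent_events.
Context {d : measure_display} {T : measurableType d} {R : realType}.
Variables (P : probability T R) (I : eqType) (X : I -> T -> nat).

Definition joint_event (l : seq I) (v : I -> nat) : set T :=
  \bigcap_(i in [set i | i \in l]) (X i @^-1` [set v i]).

(** One product formula says that [A] is independent of the variables indexed by [S] and that, given
    [A], these stay independent with unchanged laws. No sigma-algebras are involved. *)
Definition indep_event (S : pred I) (A : set T) : Prop :=
  [/\ measurable A, forall i v, S i -> measurable (X i @^-1` [set v]) &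
   forall (l : seq I) (v : I -> nat), uniq l -> all S l ->
     P (A `&` joint_event l v) = (P A * \prod_(i <- l) P (X i @^-1` [set v i]))%E].

Lemma joint_event_nil v : joint_event [::] v = setT.
Proof. by apply/seteqP; split => t // _ i. Qed.

Lemma joint_event_cons i l v :
  joint_event (i :: l) v = X i @^-1` [set v i] `&` joint_event l v.
Proof.
apply/seteqP; split => [t H|t [H1 H2] j] /=.
  split; first by apply: H; rewrite /= mem_head.
  by move=> j jl; apply: H; rewrite /= inE; apply/orP; right.
by rewrite inE => /orP[/eqP ->|/H2].
Qed.

Lemma eq_joint_event l (v w : I -> nat) : {in l, v =1 w} ->
  joint_event l v = joint_event l w.
Proof.
move=> vw; apply/seteqP; split => t H i /= il; have := H i il; rewrite /= vw //.
Qed.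

Lemma measurable_joint_event (S : pred I) l v :
  (forall i v, S i -> measurable (X i @^-1` [set v])) -> all S l ->
  measurable (joint_event l v).
Proof.
move=> mX; elim: l => [|i l IH] /=; first by rewrite joint_event_nil.
move=> /andP[Si /IH]; rewrite joint_event_cons => ?.
by apply: measurableI => //; exact: mX.
Qed.

Lemma indep_event_sub (S S' : pred I) A : {subset S' <= S} ->
  indep_event S A -> indep_event S' A.
Proof.
move=> sub [mA mX H]; split => // [i v /sub|l v ul /allP al]; first exact: mX.
by apply: H => //; apply/allP => i /al /sub.
Qed.

Lemma indep_event_cons (S : pred I) A i v : S i -> indep_event S A ->
  P (A `&` X i @^-1` [set v]) = (P A * P (X i @^-1` [set v]))%E.
Proof.
move=> Si [_ _ /(_ [:: i] (fun=> v) isT)] /=.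
by rewrite joint_event_cons joint_event_nil setIT Si big_seq1; apply.
Qed.

(** The factor of index [i] is moved from the joint event into [A]; hence [i] must leave [S]. *)
Lemma indep_event_setI (S : pred I) A i v : S i -> indep_event S A ->
  indep_event [pred j | S j & j != i] (A `&` X i @^-1` [set v]).
Proof.
move=> Si iA; have [mA mX H] := iA; split.
- by apply: measurableI => //; exact: mX.
- by move=> j w /andP[Sj _]; exact: mX.
move=> l w ul /allP al.
have il : i \notin l by apply/negP => /al /=; rewrite eqxx andbF.
(* The prescribed values [w] on [l] and [v] at [i] are merged into one assignment on [i :: l]. *)
pose u j := if j == i then v else w j.
have ui : u i = v by rewrite /u eqxx.
have uw : {in l, w =1 u}.
  by move=> j jl; rewrite /u; case: eqVneq => // ji; rewrite -ji jl in il.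
have -> : A `&` X i @^-1` [set v] `&` joint_event l w = A `&` joint_event (i :: l) u.
  by rewrite joint_event_cons (eq_joint_event uw) ui setIA.
rewrite H /=; last 2 first.
- by rewrite il.
- by rewrite Si; apply/allP => j /al /andP[].
rewrite (indep_event_cons v Si iA) big_cons muleA ui; congr (_ * _)%E.
by apply: eq_big_seq => j /uw ->.
Qed.

(** The product formula is additive in [A], so it may be checked on the slices of [A] by the values
    of [Z]. *)
Lemma indep_event_fibers (S : pred I) A (Z : T -> nat) :
  measurable A -> (forall i v, S i -> measurable (X i @^-1` [set v])) ->
  (forall v, measurable (Z @^-1` [set v])) ->
  (forall v, indep_event S (A `&` Z @^-1` [set v])) -> indep_event S A.
Proof.
move=> mA mX mZ H; split => // l v ul al.
have mJ : measurable (joint_event l v).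
  exact: measurable_joint_event v mX al.
rewrite (measure_fibers P (measurableI _ _ mA mJ) mZ).
rewrite (measure_fibers P mA mZ) muleC.
have /fineK c_fin : (\prod_(i <- l) P (X i @^-1` [set v i]))%E \is a fin_num.
  rewrite big_seq; elim/big_ind: _ => [//|x y|i il]; first exact: fin_numM.
  by apply: fin_num_measure; apply: mX; exact: (allP al).
rewrite -c_fin -nneseriesZl //; apply: eq_eseriesr => w _.
by have [_ _ /(_ l v ul al) E] := H w; rewrite setIAC E c_fin muleC.
Qed.

Lemma indep_event0 (S : pred I) :
  (forall i v, S i -> measurable (X i @^-1` [set v])) -> indep_event S set0.
Proof. by move=> mX; split => // l v _ _; rewrite set0I measure0 mul0e. Qed.

Lemma measurable_sum_fibers (S : pred I) l c :
  (forall i v, S i -> measurable (X i @^-1` [set v])) -> all S l ->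
  measurable ((fun t => \sum_(i <- l) X i t)%N @^-1` [set c]).
Proof.
move=> mX; elim: l c => [|x l IH] c /=.
  move=> _; under eq_fun do rewrite big_nil.
  by rewrite preimage_cst; case: ifP.
move=> /andP[Sx /IH {}IH].
have mXx v : measurable (X x @^-1` [set v]) by exact: mX.
rewrite (_ : _ @^-1` _ = \bigcup_v (X x @^-1` [set v] `&`
    if (v <= c)%N then (fun t => \sum_(i <- l) X i t)%N @^-1` [set (c - v)%N] else set0)).
  by apply: bigcupT_measurable => v; apply: measurableI => //; case: ifP.
apply/seteqP; split => t /=.
  rewrite big_cons => <-; exists (X x t) => //=; split => //=.
  by rewrite leq_addr /= addKn.
move=> [v _ [/= <-]]; case: ifP => // vc /= H.
by rewrite big_cons H subnKC.
Qed.

(** Slice by the value [v] of the first summand: the remaining ones must add up to [c - v], and the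
    induction hypothesis applies with the event of that slice in place of [A]. *)
Lemma indep_event_sum (S : pred I) A l c : uniq l -> all S l -> indep_event S A ->
  indep_event [pred j | S j & j \notin l]
    (A `&` (fun t => \sum_(i <- l) X i t)%N @^-1` [set c]).
Proof.
elim: l S A c => [|x l IH] S A c /=.
  move=> _ _ iA; have [mA mX _] := iA.
  under [X in X @^-1` _]eq_fun do rewrite big_nil.
  apply: (@indep_event_sub S) => [j /andP[]//|].
  rewrite preimage_cst; case: ifP => _; first by rewrite setIT.
  by rewrite setI0; exact: indep_event0.
move=> /andP[xl ul] /andP[Sx al] iA; have [mA mX _] := iA.
apply: (@indep_event_fibers _ _ (X x)).
- apply: measurableI => //; apply: measurable_sum_fibers mX _.
  by rewrite /= Sx.
- by move=> i v /andP[/mX].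
- by move=> v; exact: mX.
move=> v; have [vc|vc] := leqP v c; last first.
  rewrite [Y in indep_event _ Y](_ : _ = set0).
    by apply: indep_event0 => i w /andP[/mX].
  apply/seteqP; split => t //= -[[_]]; rewrite big_cons => tc vE.
  by move: vc; rewrite -tc -vE ltnNge leq_addr.
rewrite [Y in indep_event _ Y](_ : _ = A `&` X x @^-1` [set v] `&`
    (fun t => \sum_(i <- l) X i t)%N @^-1` [set (c - v)%N]).
  apply: (@indep_event_sub [pred j | [pred j | S j & j != x] j & j \notin l]).
    by move=> j; rewrite !inE negb_or => /and3P[Sj jx jl]; rewrite -!topredE /= Sj jx.
  apply: IH => //; last exact: indep_event_setI.
  apply/allP => j jl /=; rewrite (allP al) //=.
  by apply: contraNneq xl => <-.
apply/seteqP; split => t /=; rewrite big_cons.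
  by move=> [[At <-] tv]; rewrite -tv addKn.
by move=> [[At tv] ->]; rewrite tv subnKC.
Qed.

(* Total mass 1, mean [m] and variance [s] in one identity between nonnegative
   series, which spares all integrability side conditions. *)
Definition centered_moments (x : I) (m s : R) : Prop := forall u g : R,
  (\sum_(v <oo) P (X x @^-1` [set v]) * ((u + g * (v%:R - m)) ^+ 2)%:E =
   (u ^+ 2 + g ^+ 2 * s)%:E)%E.

Lemma centered_moments_ge0 x m s : centered_moments x m s -> 0 <= s.
Proof.
move=> /(_ 0 1); rewrite expr0n expr1n add0r mul1r -lee_fin => <-.
by apply: nneseries_ge0 => v _ _; apply: mule_ge0 => //; rewrite lee_fin sqr_ge0.
Qed.

Lemma centered_moments_cst x m s u g k : centered_moments x m s -> 0 <= k ->
  (\sum_(v <oo) P (X x @^-1` [set v]) * ((u + g * (v%:R - m)) ^+ 2 + k)%:E =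
   (u ^+ 2 + g ^+ 2 * s + k)%:E)%E.
Proof.
move=> mom k0.
have mass : (\sum_(v <oo) P (X x @^-1` [set v]) * k%:E = k%:E)%E.
  (* Taking [u = sqrt k] and [g = 0] isolates the total mass. *)
  have := mom (Num.sqrt k) 0; rewrite sqr_sqrtr // expr0n mul0r addr0 => M.
  rewrite -[RHS]M; apply: eq_eseriesr => v _; rewrite mul0r addr0 sqr_sqrtr //.
rewrite [RHS]EFinD -mom -mass -nneseriesD.
- by apply: eq_eseriesr => v _; rewrite EFinD ge0_muleDr // lee_fin sqr_ge0.
- by move=> v _ _; apply: mule_ge0 => //; rewrite lee_fin sqr_ge0.
- by move=> v _ _; apply: mule_ge0.
Qed.

Lemma measurable_centered_sum (S : pred I) (A : set T) l (m : I -> R) :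
  measurable A -> (forall i v, S i -> measurable (X i @^-1` [set v])) ->
  all S l -> measurable_fun A (fun t => \sum_(i <- l) ((X i t)%:R - m i)).
Proof.
move=> mA mX; elim: l => [|x l IH] /=.
  by move=> _; under eq_fun do rewrite big_nil; exact: measurable_cst.
move=> /andP[Sx /IH {}IH]; under eq_fun do rewrite big_cons.
apply: measurable_funD => //.
by apply: (@measurable_fun_countable _ _ _ _ _ (X x) (fun v => v%:R - m x)) => // v; exact: mX.
Qed.

(** Variances add up without expanding the square: on the slice where the first variable equals [v],
    the term [g * (v - m x)] is absorbed into [u], and the moment identity of that variable then
    sums over [v]. *)
Lemma integral_centered_sum_sqr (S : pred I) A l (m s : I -> R) u g :
  (forall i, i \in l -> centered_moments i (m i) (s i)) ->
  uniq l -> all S l -> indep_event S A ->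
  (\int[P]_(t in A) ((u + g * \sum_(i <- l) ((X i t)%:R - m i)) ^+ 2)%:E =
   P A * (u ^+ 2 + g ^+ 2 * \sum_(i <- l) s i)%:E)%E.
Proof.
elim: l S A u => [|x l IH] S A u mom /=.
  move=> _ _ [mA _ _]; under eq_integral do rewrite big_nil.
  by rewrite integral_cst // big_nil !mulr0 !addr0 muleC.
move=> /andP[xl ul] /andP[Sx al] iA; have [mA mX _] := iA.
have mf : measurable_fun A (fun t =>
    ((u + g * \sum_(i <- x :: l) ((X i t)%:R - m i)) ^+ 2)%:E).
  apply/measurable_EFinP; apply: measurable_funX.
  apply: measurable_funD => //; apply: measurable_funM => //.
  by apply: measurable_centered_sum mA mX _; rewrite /= Sx.
rewrite (@ge0_integral_fibers _ _ _ _ (X x)) //; last 2 first.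
- by move=> v; exact: mX.
- by move=> t; rewrite lee_fin sqr_ge0.
have s0 : 0 <= g ^+ 2 * \sum_(i <- l) s i.
  apply: mulr_ge0; rewrite ?sqr_ge0 // big_seq; apply: sumr_ge0 => i il.
  by apply/centered_moments_ge0/mom; rewrite inE il orbT.
rewrite big_cons mulrDr addrA.
rewrite -(centered_moments_cst u g (mom x (mem_head x l)) s0) measure_nneseriesZl //; last first.
  by move=> v; apply: mule_ge0 => //; rewrite lee_fin addr_ge0 // sqr_ge0.
apply: eq_eseriesr => v _; rewrite muleA -(indep_event_cons v Sx iA).
rewrite -(IH [pred j | S j & j != x]) //; last 3 first.
- by move=> i il; apply: mom; rewrite inE il orbT.
- apply/allP => j jl /=; rewrite (allP al) //=.
  by apply: contraNneq xl => <-.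
- exact: indep_event_setI.
apply: eq_integral => t; rewrite inE => -[_ /= Xv].
by rewrite big_cons mulrDr addrA Xv.
Qed.
End independent_events.

(** * Moments of the Bernoulli variables and of the innovations *)

Section moments.
Context {d : measure_display} {T : measurableType d} {R : realType}.
Variables (P : probability T R) (I : eqType) (X : I -> T -> nat).

Lemma bernoulli_centered_moments x (a : R) :
  (forall v, measurable (X x @^-1` [set v])) ->
  P (X x @^-1` [set 1%N]) = a%:E -> P (X x @^-1` [set 0%N]) = (1 - a)%:E ->
  centered_moments P X x a (a * (1 - a)).
Proof.
move=> mX P1 P0 u g.
rewrite (nneseries_split 0 2); last first.
  by move=> v _; apply: mule_ge0 => //; rewrite lee_fin sqr_ge0.
rewrite add0n eseries0 ?adde0; last first.
  move=> v v2 _; rewrite (_ : P _ = 0%E) ?mul0e //.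
  (* The probabilities of 0 and 1 add up to one, so the values from 2 on are null. *)
  pose B := X x @^-1` [set 0%N] `|` X x @^-1` [set 1%N].
  have mB : measurable B by apply: measurableU.
  have PB : P (~` B) = 0%E.
    rewrite probability_setC //.
    have -> : (P B = P (X x @^-1` [set 0%N]) + P (X x @^-1` [set 1%N]))%E.
      by apply: measureU => //; apply/seteqP; split => t //= [-> ].
    by rewrite P0 P1 -EFinD subrK subrr.
  apply: subset_measure0 PB => //; first exact: measurableC.
  by move=> t /= tv; rewrite /B /= tv => -[] v01; rewrite v01 in v2.
rewrite !big_nat_recr //= big_geq // add0e P0 P1 -!EFinM -EFinD; congr EFin.
by ring.
Qed.

(** Integrability is known for [x] alone; the identity involves only the law and so carries over to
    [y]. The series is the integral of the square, which is then expanded. *)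
Lemma square_integrable_centered_moments x y (mu : R) :
  (forall v, measurable (X x @^-1` [set v])) ->
  (forall v, P (X y @^-1` [set v]) = P (X x @^-1` [set v])) ->
  P.-integrable setT (fun t => (((X x t)%:R : R) ^+ 2)%:E) ->
  (\int[P]_t ((X x t)%:R : R)%:E = mu%:E)%E ->
  centered_moments P X y mu
    (fine (\int[P]_t (((X x t)%:R : R) ^+ 2)%:E) - mu ^+ 2).
Proof.
move=> mX yx i2 mom1 u g.
have mfX (F : nat -> R) : measurable_fun setT (fun t => (F (X x t))%:E).
  by apply: (measurable_fun_countable (fun v => (F v)%:E)).
have i1 : P.-integrable setT (fun t => ((X x t)%:R : R)%:E).
  apply/integrableP; split; first exact: (mfX (fun v => v%:R)).
  under eq_integral do rewrite gee0_abs ?lee_fin //.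
  by rewrite mom1 ltry.
transitivity (\int[P]_t ((u + g * ((X x t)%:R - mu)) ^+ 2)%:E)%E.
  rewrite (@ge0_integral_fibers _ _ _ _ (X x)) //; last 2 first.
  - exact: (mfX (fun v => (u + g * (v%:R - mu)) ^+ 2)).
  - by move=> t; rewrite lee_fin sqr_ge0.
  apply: eq_eseriesr => v _; rewrite setTI yx muleC -integral_cst //.
  by apply: eq_integral => t; rewrite inE /= => ->.
transitivity (\int[P]_t (((u - g * mu) ^+ 2)%:E + (2 * (u - g * mu) * g)%:E * ((X x t)%:R : R)%:E + (g ^+ 2)%:E * (((X x t)%:R : R) ^+ 2)%:E))%E.
  by apply: eq_integral => t _; rewrite -!EFinM -!EFinD; congr EFin; ring.
have i0 r : P.-integrable setT (fun=> r%:E) by exact: finite_measure_integrable_cst.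
rewrite integralD //=; last 2 first.
- by apply: integrableD => //; exact: integrableZl.
- exact: integrableZl.
rewrite integralD //=; last exact: integrableZl.
have -> r : (\int[P]__ r%:E = r%:E)%E.
  rewrite -[RHS]mule1 -(probability_setT P); exact: integral_cst.
rewrite !integralZl // mom1.
rewrite -[X in (_ + _ * X)%E]fineK; last exact: integral_fune_fin_num.
rewrite -!EFinM -!EFinD; congr EFin.
by ring.
Qed.
End moments.

(** * Deterministic estimates *)

Section least_squares_weights.
Context {R : realType}.
Variables (s : nat) (y : nat -> nat).

(** The denominator of [alpha_tilde], with the time shifted by one: [design k.+1] involves
    [y 0, ..., y k] only. *)
Definition design (n : nat) : nat := \sum_(0 <= k < n | k.+1 != s) y k ^ 2.

(* The increment of the design at time [s] is skipped; while the design vanishes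
   so does [y k], and the quotient is [0 / 0 = 0]. *)
Definition weight (k : nat) : R :=
  if k.+1 != s then (y k)%:R / (design k.+1)%:R else 0.

Lemma designS n : design n.+1 = (design n + if n.+1 != s then y n ^ 2 else 0)%N.
Proof. by rewrite /design 2![in LHS]big_mkcond /= big_nat_recr //= -big_mkcond. Qed.

Lemma design_nondecreasing : {homo design : m n / (m <= n)%N}.
Proof. by apply: homo_leq => // [|n]; [exact: leq_trans|rewrite designS leq_addr]. Qed.

Lemma weight_design k : (design k.+1)%:R * weight k = if k.+1 != s then (y k)%:R else 0 :> R.
Proof.
rewrite /weight; case: ifP => [ks|]; last by rewrite mulr0.
have [y0|y0] := posnP (y k); first by rewrite y0 mul0r mulr0.
rewrite mulrCA divff ?mulr1 // pnatr_eq0 designS ks.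
by rewrite addn_eq0 negb_and orbC -lt0n expn_gt0 y0.
Qed.

(* The partial sums are dominated by the telescoping [3 - 2 / sqrt D_n]. *)
Lemma weight_sqr_sum_bound (c v : R) n : 0 <= c -> 0 <= v ->
  \sum_(0 <= k < n) weight k ^+ 2 * (c * (y k)%:R + v) <= 3 * (c + v).
Proof.
move=> c0 v0.
suff : if design n == 0%N then \sum_(0 <= k < n) weight k ^+ 2 * (c * (y k)%:R + v) = 0
    else \sum_(0 <= k < n) weight k ^+ 2 * (c * (y k)%:R + v) <=
         (c + v) * (3 - 2 / Num.sqrt (design n)%:R).
  case: ifP => [_ ->|_ /le_trans]; first by rewrite mulr_ge0 // addr_ge0.
  have q0 : 0 <= 2 / Num.sqrt (design n)%:R :> R by rewrite divr_ge0 // sqrtr_ge0.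
  by apply; have := mulr_ge0 (addr_ge0 c0 v0) q0; lra.
elim: n => [|n IH]; first by rewrite /design !big_geq // eqxx.
rewrite big_nat_recr //=; set S := \sum_(0 <= k < n) _ in IH *.
have [y0|y0] := posnP (if n.+1 != s then y n else 0%N).
  have -> : weight n = 0.
    by move: y0; rewrite /weight; case: ifP => // _ ->; rewrite mul0r.
  rewrite expr0n mul0r addr0 designS.
  have -> : (if n.+1 != s then y n ^ 2 else 0)%N = 0%N.
    by move: y0; case: ifP => // _ ->.
  by rewrite addn0.
move: y0; case: ifP => // ns y0.
have dE : design n.+1 = (design n + y n ^ 2)%N by rewrite designS ns.
have d_gt0 : (0 < design n.+1)%N by rewrite dE addn_gt0 expn_gt0 y0 orbT.
rewrite eqn0Ngt d_gt0 /= /weight ns.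
set b := Num.sqrt (design n.+1)%:R.
have bE : b ^+ 2 = (design n.+1)%:R by rewrite sqr_sqrtr.
have b0 : 0 < b by rewrite sqrtr_gt0 ltr0n.
have b1 : 1 <= b by rewrite -[leLHS]sqrtr1 ler_wsqrtr // ler1n.
set Y : R := (y n)%:R.
have Y1 : 1 <= Y by rewrite ler1n.
have Yb : Y <= b.
  rewrite -[leLHS]ger0_norm // -sqrtr_sqr ler_wsqrtr // -natrX ler_nat dE.
  exact: leq_addl.
have cv0 : 0 <= c + v by exact: addr_ge0.
(* Here [c * Y + v <= (c + v) * b], because [Y <= b] and [1 <= b]. *)
have term : (Y / (design n.+1)%:R) ^+ 2 * (c * Y + v) <= (c + v) * (Y ^+ 2 / b ^+ 3).
  rewrite -bE.
  have -> : (Y / b ^+ 2) ^+ 2 * (c * Y + v) = (Y ^+ 2 / b ^+ 3) * ((c * Y + v) / b).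
    by field; rewrite gt_eqF.
  rewrite mulrC; apply: ler_wpM2r.
    by rewrite divr_ge0 ?sqr_ge0 // exprn_ge0 // ltW.
  by rewrite ler_pdivrMr // mulrDl lerD // ?ler_wpM2l // ler_peMr.
(* At the first nonzero design [Y = b], so the term is at most [(c + v) / b], and
   [1 / b <= 3 - 2 / b] as [1 <= b]. This start is what fixes the constant 3. *)
move: IH; case: ifPn => [/eqP dn0 ->|dn0 IH].
  rewrite add0r; apply: le_trans term _; rewrite ler_wpM2l //.
  have -> : Y ^+ 2 = b ^+ 2 by rewrite bE dE dn0 add0n natrX.
  have -> : b ^+ 2 / b ^+ 3 = b^-1 by field; rewrite gt_eqF.
  have : b^-1 <= 1 by rewrite invf_le1.
  by lra.
apply: le_trans (lerD IH term) _; rewrite -mulrDr ler_wpM2l //.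
set a := Num.sqrt (design n)%:R.
have aE : a ^+ 2 = (design n)%:R by rewrite sqr_sqrtr.
have a0 : 0 < a by rewrite sqrtr_gt0 ltr0n lt0n.
have YE : Y ^+ 2 = b ^+ 2 - a ^+ 2 by rewrite aE bE dE natrD natrX addrC addKr.
have ab : a <= b by rewrite ler_wsqrtr // ler_nat dE leq_addr.
rewrite YE -subr_ge0.
(* With [Y ^+ 2 = b ^+ 2 - a ^+ 2], the telescoping step amounts to [a * (a + b) <= 2 * b ^+ 2],
   true for [a <= b]. *)
have -> : 3 - 2 / b - (3 - 2 / a + (b ^+ 2 - a ^+ 2) / b ^+ 3) =
    (b - a) * (2 * b ^+ 2 - a * (a + b)) / (a * b ^+ 3).
  by field; rewrite !gt_eqF.
apply: divr_ge0; last by rewrite ltW // mulr_gt0 // exprn_gt0.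
by apply: mulr_ge0; rewrite ?subr_ge0 //; nra.
Qed.

End least_squares_weights.

(** * Kronecker's lemma *)

Section kronecker.
Context {R : realType}.
Variables (D x : nat -> R).
Hypothesis D_ge0 : forall n, 0 <= D n.
Hypothesis D_mono : {homo D : m n / (m <= n)%N >-> m <= n}.

Let S n := \sum_(0 <= k < n) x k.
Let N n := \sum_(0 <= k < n) D k.+1 * x k.

(** Summation by parts: the difference between the increment of [N] and [D] times that of [S]
    changes by [(D k.+1 - D k) * (S k - S m)] at each step, so its bound telescopes. *)
Lemma kronecker_increment e m j :
  (forall i, `|S (m + i)%N - S m| <= e) ->
  `|N (m + j)%N - N m| <= 2 * e * D (m + j)%N.
Proof.
move=> Se.
have e0 : 0 <= e by apply: le_trans (Se 0%N); exact: normr_ge0.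
suff H : `|N (m + j)%N - N m - D (m + j)%N * (S (m + j)%N - S m)| <=
    e * (D (m + j)%N - D m).
  have -> : N (m + j)%N - N m = (N (m + j)%N - N m - D (m + j)%N * (S (m + j)%N - S m))
    + D (m + j)%N * (S (m + j)%N - S m) by rewrite subrK.
  apply: le_trans (ler_normD _ _) _; rewrite normrM (ger0_norm (D_ge0 _)).
  have H2 := ler_wpM2l (D_ge0 (m + j)%N) (Se j).
  have H3 := mulr_ge0 e0 (D_ge0 m).
  by lra.
elim: j => [|j IH]; first by rewrite addn0 !subrr mulr0 subr0 normr0 mulr0.
rewrite addnS; set k := (m + j)%N in IH *.
have -> : N k.+1 - N m - D k.+1 * (S k.+1 - S m) =
    (N k - N m - D k * (S k - S m)) - (D k.+1 - D k) * (S k - S m).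
  by rewrite /N /S !(big_nat_recr k) //=; ring.
apply: le_trans (ler_normB _ _) _.
have Dk : 0 <= D k.+1 - D k by rewrite subr_ge0 D_mono.
have := ler_wpM2l Dk (Se j); rewrite -/k normrM (ger0_norm Dk) => H.
by lra.
Qed.

Lemma kronecker :
  (forall B, exists n, B <= D n) ->
  (forall e, 0 < e -> exists m, forall i, `|S (m + i)%N - S m| <= e) ->
  (fun n => N n / D n) @ \oo --> (0 : R).
Proof.
move=> D_unbounded S_cauchy; apply/cvgrPdist_le => e e0.
(* The increment after [m] then costs [e / 2]; the other half is for the fixed [N m]. *)
have e4 : 0 < e / 4 by rewrite divr_gt0.
have [m Sm] := S_cauchy _ e4.
(* The added 1 keeps [D n] positive even if [N m] is zero. *)
have [n0 Dn0] := D_unbounded (`|N m| / (e / 2) + 1).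
exists (maxn m n0) => // n /=; rewrite geq_max => /andP[mn n0n].
have Dn := le_trans Dn0 (D_mono n0n).
have Dn_gt0 : 0 < D n.
  by apply: lt_le_trans Dn; rewrite ltr_pwDr // divr_ge0 // divr_ge0 // ltW.
rewrite sub0r normrN normrM normfV (gtr0_norm Dn_gt0) ler_pdivrMr //.
have := kronecker_increment (n - m) Sm; rewrite subnKC // => H.
rewrite -(subrK (N m) (N n)); apply: le_trans (ler_normD _ _) _.
have : `|N m| <= D n * (e / 2).
  by rewrite -ler_pdivrMr ?divr_gt0 //; apply: le_trans Dn; rewrite lerDl.
by lra.
Qed.

End kronecker.

(** * The INAR(1) noise *)

Definition inar_level (i : inar_index) : nat :=
  match i with inl _ => 0 | inr (inl k) => k | inr (inr (k, _)) => k end.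

Definition later_index (k : nat) : pred inar_index :=
  [pred i | inar_valid i & (k < inar_level i)%N].

(** The variables that drive the step to time [k] from state [n]. The state is a fixed number here:
    the random number of summands is frozen by fixing the history. *)
Definition step_indices (k n : nat) : seq inar_index :=
  inr (inl k) :: [seq inr (inr (k, j.+1)) | j <- iota 0 n].

Lemma uniq_step_indices k n : uniq (step_indices k n).
Proof.
rewrite /= map_inj_uniq ?iota_uniq ?andbT; last by move=> i j [].
by apply/mapP => -[].
Qed.

Lemma all_later_step_indices k n : all (later_index k) (step_indices k.+1 n).
Proof.
rewrite /= /later_index /= ltnSn /=.
by apply/allP => _ /mapP[j _ ->] /=; rewrite ltnSn.
Qed.

Section inar.
Context {d : measure_display} {T : measurableType d} {R : realType}.
Variables (P : probability T R) (alpha : R).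
Variables (Y0 : T -> nat) (eps : nat -> T -> nat) (xi : nat -> nat -> T -> nat).
Variables (mu : R) (s theta : nat).

Let X := inar_family Y0 eps xi.
Let Y := inarY Y0 eps xi s theta.
Let outlier k := if k == s then theta else 0%N.

Hypothesis indepX : mutually_independent_nat P inar_valid X.

Lemma inarYS k t :
  Y k.+1 t = ((\sum_(i <- step_indices k.+1 (Y k t)) X i t) + outlier k.+1)%N.
Proof.
rewrite big_cons /= [X in (_ + X + _)%N]big_map -[X in iota 0 X]subn0 -/(index_iota _ _).
by rewrite big_mkord [(eps _ _ + _)%N]addnC.
Qed.

(** Its values lie in a countable type, so every event of the past is a countable union of
    fibers. *)
Definition inar_history k (t : T) : seq nat := mkseq (fun i => Y i t) k.+1.

Lemma inar_historyS k t : inar_history k.+1 t = rcons (inar_history k t) (Y k.+1 t).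
Proof. by rewrite /inar_history mkseqS. Qed.

Lemma last_inar_history k t : last 0%N (inar_history k t) = Y k t.
Proof. by rewrite /inar_history mkseqS last_rcons. Qed.

Lemma indep_event_setT : indep_event P X inar_valid setT.
Proof.
case: indepX => mX H; split => // l v ul al; rewrite setTI.
by rewrite H // [Z in (Z * _)%E](probability_setT P) mul1e.
Qed.

(** The last entry of a history fixes which variables drive the next step. Extending the history
    therefore prescribes the sum of a fixed list of later variables, which [indep_event_sum]
    absorbs; those of still later levels remain. *)
Lemma indep_inar_history k h :
  indep_event P X (later_index k) (inar_history k @^-1` [set h]).
Proof.
have mX i v : inar_valid i -> measurable (X i @^-1` [set v]).
  by case: indepX => + _; apply.
have i0 k' : indep_event P X (later_index k') set0.
  by apply: indep_event0 => i v /andP[/mX].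
have iT := indep_event_setT.
elim: k h => [|k IH] h.
  have [[y ->]|hn] := pselect (exists y, h = [:: y]); last first.
    rewrite (_ : _ @^-1` _ = set0) //; apply/seteqP; split => // t /= th.
    by apply: hn; exists (Y 0 t).
  have -> : inar_history 0 @^-1` [set [:: y]] = setT `&` X (inl tt) @^-1` [set y].
    rewrite setTI; apply/seteqP; split => t /=; first by case.
    by move=> Yt; rewrite /inar_history /mkseq /= -Yt.
  apply: indep_event_sub (indep_event_setI y (isT : inar_valid (inl tt)) iT).
  by move=> i; rewrite -!topredE /= => /andP[-> ]; case: i => [[]|].
case/lastP: h => [|h y].
  by rewrite (_ : _ @^-1` _ = set0) //; apply/seteqP; split.
pose l := step_indices k.+1 (last 0%N h).
have hE : inar_history k.+1 @^-1` [set rcons h y] = inar_history k @^-1` [set h] `&`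
    [set t | (\sum_(i <- l) X i t + outlier k.+1)%N = y].
  apply/seteqP; split => t /=; rewrite inar_historyS.
    move=> /rcons_inj[th <-]; split => //.
    by rewrite inarYS /l -th last_inar_history.
  by move=> [th <-]; rewrite inarYS /l -th last_inar_history.
rewrite {}hE.
(* The outlier is a deterministic shift, to be subtracted from the prescribed value; a value below
   it is impossible. *)
have [cy|yc] := leqP (outlier k.+1) y; last first.
  rewrite [B in indep_event _ _ _ B](_ : _ = set0) //.
  apply/seteqP; split => // t /= [_ ty].
  by move: yc; rewrite -ty ltnNge leq_addl.
rewrite [B in indep_event _ _ _ B](_ : _ = inar_history k @^-1` [set h] `&`
    (fun t => \sum_(i <- l) X i t)%N @^-1` [set (y - outlier k.+1)%N]); last first.
  apply/seteqP; split => t /= [th ty]; split => //; first by rewrite -ty addnK.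
  by rewrite ty subnK.
apply: indep_event_sub (indep_event_sum _ (uniq_step_indices k.+1 _)
  (all_later_step_indices k _) (IH h)).
move=> i; rewrite -!topredE /= /later_index /= => /andP[-> ki]; rewrite (ltnW ki) /=.
rewrite inE negb_or; apply/andP; split; first by apply: contraTneq ki => ->; rewrite /= ltnn.
by apply/mapP => -[j _ iE]; rewrite iE /= ltnn in ki.
Qed.

Lemma measurable_inar_history k h : measurable (inar_history k @^-1` [set h]).
Proof. by case: (indep_inar_history k h). Qed.

(** * Functions of the past and conditional second moments of the noise *)

Definition adapted (k : nat) {V : Type} (U : T -> V) : Prop :=
  forall t t', (forall i, (i <= k)%N -> Y i t = Y i t') -> U t = U t'.

Lemma adapted_history k (V : Type) (U : T -> V) t t' : adapted k U ->
  inar_history k t = inar_history k t' -> U t = U t'.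
Proof.
move=> aU tt'; apply: aU => i ik.
have := congr1 (fun h => nth 0%N h i) tt'.
by rewrite !nth_mkseq.
Qed.

(** The past takes countably many values, so a function of it is measurable whatever its form;
    [adapted] thus stands in for the natural filtration. *)
Lemma measurable_adapted k {d'} {V : measurableType d'} (U : T -> V) :
  adapted k U -> measurable_fun setT U.
Proof.
move=> aU _ B _; rewrite setTI.
rewrite (_ : U @^-1` B = inar_history k @^-1` (inar_history k @` (U @^-1` B))).
  apply: measurable_preimage_countable => h; exact: measurable_inar_history.
apply/seteqP; split => t /=; first by move=> Bt; exists t.
by move=> [t' Bt' /(adapted_history aU) <-].
Qed.

Definition inar_noise k (t : T) : R :=
  (Y k.+1 t)%:R - alpha * (Y k t)%:R - mu - (outlier k.+1)%:R.

Variable sg2 : R.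
Hypothesis eps_moments : forall k, (0 < k)%N ->
  centered_moments P X (inr (inl k)) mu sg2.
Hypothesis xi_moments : forall k j, (0 < k)%N -> (0 < j)%N ->
  centered_moments P X (inr (inr (k, j))) alpha (alpha * (1 - alpha)).

Definition inar_variance k (t : T) : R := alpha * (1 - alpha) * (Y k t)%:R + sg2.

Let xi_variance_ge0 : 0 <= alpha * (1 - alpha).
Proof. exact: centered_moments_ge0 (xi_moments (isT : 0 < 1)%N (isT : 0 < 1)%N). Qed.

Let sg2_ge0 : 0 <= sg2.
Proof. exact: centered_moments_ge0 (eps_moments (isT : 0 < 1)%N). Qed.

Lemma inar_variance_ge0 k t : 0 <= inar_variance k t.
Proof. by rewrite addr_ge0 // mulr_ge0. Qed.

(** The absence of a cross term is the martingale difference property, and [inar_variance] is the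
    conditional variance. Once the history is fixed, [U] and [G] are constants and the noise is a
    centered sum of independent variables. *)
Lemma integral_noise_sqr k (U G : T -> R) : adapted k U -> adapted k G ->
  (\int[P]_t ((U t + G t * inar_noise k t) ^+ 2)%:E =
   \int[P]_t (U t ^+ 2 + G t ^+ 2 * inar_variance k t)%:E)%E.
Proof.
move=> aU aG.
apply: (@eq_integral_fibers _ _ _ _ _ (inar_history k)).
- by move=> h; exact: measurable_inar_history.
- apply: (@measurable_adapted k.+1) => t t' tt'; rewrite /inar_noise !tt' //.
  rewrite (aU t t') ?(aG t t') // => i ik; apply: tt'; exact: leqW.
- apply: (@measurable_adapted k) => t t' tt'; rewrite /inar_variance !tt' //.
  by rewrite (aU t t') ?(aG t t').
- by move=> t; rewrite lee_fin sqr_ge0.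
- by move=> t; rewrite lee_fin addr_ge0 ?sqr_ge0 // mulr_ge0 ?sqr_ge0 // inar_variance_ge0.
move=> h.
have [[t0 th]|hn] := pselect (exists t, inar_history k t = h); last first.
  rewrite (_ : _ @^-1` _ = set0) ?integral_set0 //; apply/seteqP; split => // t /= th.
  by apply: hn; exists t.
have mh := measurable_inar_history k h.
pose l := step_indices k.+1 (Y k t0).
pose m (i : inar_index) : R := if i is inr (inl _) then mu else alpha.
pose v (i : inar_index) : R := if i is inr (inl _) then sg2 else alpha * (1 - alpha).
have tE (V : Type) (W : T -> V) t : adapted k W -> inar_history k t = h -> W t = W t0.
  by move=> aW; rewrite -th; exact: adapted_history.
have aY : adapted k (Y k) by move=> t t' ->.
transitivity (\int[P]_(t in inar_history k @^-1` [set h])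
    ((U t0 + G t0 * \sum_(i <- l) ((X i t)%:R - m i)) ^+ 2)%:E)%E.
  apply: eq_integral => t; rewrite inE /= => ht.
  rewrite (tE _ U) // (tE _ G) //; congr ((_ + _ * _) ^+ 2)%:E.
  rewrite /inar_noise inarYS (tE _ (Y k)) // natrD -/l sumrB natr_sum.
  have -> : \sum_(i <- l) m i = alpha * (Y k t0)%:R + mu.
    rewrite big_cons big_map /= big_const_seq count_predT size_iota iter_addr_0.
    by rewrite mulr_natr addrC.
  by rewrite opprD; lra.
rewrite (integral_centered_sum_sqr (s := v) _ _ _ (uniq_step_indices _ _)
  (all_later_step_indices k _) (indep_inar_history k h)).
  rewrite muleC -integral_cst //; apply: eq_integral => t; rewrite inE /= => ht.
  rewrite (tE _ U) // (tE _ G) // /inar_variance (tE _ (Y k)) //; congr (_ + _ * _)%:E.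
  rewrite big_cons big_map /= big_const_seq count_predT size_iota iter_addr_0.
  by rewrite mulr_natr addrC.
move=> i; rewrite inE => /orP[/eqP ->|/mapP[j _ ->]]; first exact: eps_moments.
exact: xi_moments.
Qed.

(** * Maximal inequality and almost sure convergence of the weighted noise *)

Let path t k := Y k t.

Lemma adapted_weight k : adapted k (fun t => weight s (path t) k : R).
Proof.
move=> t t' tt'; rewrite /weight /path (tt' k) //; case: ifP => // _.
rewrite /design; congr (_ / _%:R).
by apply: congr_big_nat => // i; rewrite ltnS => /andP[_ ik]; rewrite tt'.
Qed.

(* Frozen as soon as it exceeds [e] in absolute value: Chebyshev's inequality for
   the stopped sum is the maximal inequality for the original one. *)
Fixpoint stopped_sum (e : R) m j (t : T) : R :=
  if j is j'.+1 then
    stopped_sum e m j' t +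
    (if `|stopped_sum e m j' t| <= e then weight s (path t) (m + j') else 0) *
    inar_noise (m + j') t
  else 0.

Lemma adaptedS k (V : Type) (U : T -> V) : adapted k U -> adapted k.+1 U.
Proof. by move=> aU t t' tt'; apply: aU => i ik; apply: tt'; exact: leqW. Qed.

Lemma adapted_noise k : adapted k.+1 (inar_noise k).
Proof. by move=> t t' tt'; rewrite /inar_noise !tt'. Qed.

Lemma adapted_stopped_sum e m j : adapted (m + j) (stopped_sum e m j).
Proof.
elim: j => [|j IH] t t' tt' //=; rewrite addnS in tt'.
rewrite (adaptedS IH tt') (adapted_noise tt').
by rewrite (adaptedS (@adapted_weight (m + j)) tt').
Qed.

Definition step_variance k : \bar R :=
  (\int[P]_t (weight s (path t) k ^+ 2 * inar_variance k t)%:E)%E.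

Lemma adapted_variance k : adapted k (inar_variance k).
Proof. by move=> t t' tt'; rewrite /inar_variance tt'. Qed.

Let step_fun_ge0 k t : (0 <= (weight s (path t) k ^+ 2 * inar_variance k t)%:E)%E.
Proof. by rewrite lee_fin mulr_ge0 ?sqr_ge0 // inar_variance_ge0. Qed.

Let measurable_step k :
  measurable_fun setT (fun t => (weight s (path t) k ^+ 2 * inar_variance k t)%:E).
Proof.
apply: (@measurable_adapted k) => t t' tt'.
by rewrite (adapted_weight tt') (adapted_variance tt').
Qed.

Lemma step_variance_ge0 k : (0 <= step_variance k)%E.
Proof. exact: integral_ge0. Qed.

(** The bound of [weight_sqr_sum_bound] holds path by path with a constant free of the path, so it
    survives integration. *)
Lemma step_variance_sum n :
  (\sum_(0 <= k < n) step_variance k <= (3 * (alpha * (1 - alpha) + sg2))%:E)%E.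
Proof.
rewrite /step_variance -ge0_integral_sum //.
rewrite -[leRHS]mule1 -(probability_setT P) -integral_cst //.
apply: ge0_le_integral => //.
- by move=> t _; apply: sume_ge0.
- by apply: emeasurable_sum.
move=> t _; rewrite sumEFin lee_fin /inar_variance.
exact: weight_sqr_sum_bound.
Qed.

(** The test for freezing depends on the past only, so the coefficient of the new noise is adapted;
    replacing it by the full weight can only increase the integral. *)
Lemma integral_stopped_sum_sqr e m j :
  (\int[P]_t (stopped_sum e m j t ^+ 2)%:E <= \sum_(m <= k < m + j) step_variance k)%E.
Proof.
elim: j => [|j IH] /=.
  rewrite addn0 big_geq // expr0n /=.
  by rewrite (_ : (fun _ => _) = cst 0%E) // integral_cst // mul0e.
rewrite (@integral_noise_sqr (m + j)); last 2 first.
- exact: adapted_stopped_sum.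
- move=> t t' tt'; rewrite (@adapted_stopped_sum e m j _ _ tt').
  by rewrite (adapted_weight tt').
rewrite addnS big_nat_recr ?leq_addr //=.
apply: le_trans (leeD2r _ IH); rewrite -ge0_integralD //; last 2 first.
- by move=> t _; rewrite lee_fin sqr_ge0.
- apply: (@measurable_adapted (m + j)) => t t' tt'.
  by rewrite (@adapted_stopped_sum e m j _ _ tt').
apply: ge0_le_integral => //.
- by move=> t _; rewrite lee_fin addr_ge0 ?sqr_ge0 // mulr_ge0 ?sqr_ge0 // inar_variance_ge0.
- apply: (@measurable_adapted (m + j)) => t t' tt'.
  by rewrite (@adapted_stopped_sum e m j _ _ tt') (adapted_weight tt') (adapted_variance tt').
- apply: emeasurable_funD => //; apply: (@measurable_adapted (m + j)) => t t' tt'.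
  by rewrite (@adapted_stopped_sum e m j _ _ tt').
move=> t _; rewrite -EFinD lee_fin lerD2l; case: ifP => // _.
by rewrite expr0n mul0r -lee_fin.
Qed.

Definition weighted_noise_sum n t : R :=
  \sum_(0 <= k < n) weight s (path t) k * inar_noise k t.

(** Either the stopped sum has passed [e] and stays there, or it was never frozen and equals the
    original increment. *)
Lemma stopped_sum_exceeds e m j t : 0 <= e ->
  e < `|weighted_noise_sum (m + j) t - weighted_noise_sum m t| ->
  e < `|stopped_sum e m j t|.
Proof.
move=> e0.
suff : e < `|stopped_sum e m j t| \/
    stopped_sum e m j t = weighted_noise_sum (m + j) t - weighted_noise_sum m t.
  by case=> // ->.
elim: j => [|j IH] /=; first by right; rewrite addn0 subrr.
have [le|lt] := leP `|stopped_sum e m j t| e; last by left; rewrite mul0r addr0.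
case: IH => [|->]; first by rewrite ltNge le.
right; rewrite addnS /weighted_noise_sum [in RHS]big_nat_recr //=.
by rewrite addrAC.
Qed.

Lemma stopped_sum_absorbed e m j t :
  e < `|stopped_sum e m j t| -> e < `|stopped_sum e m j.+1 t|.
Proof. by move=> lt /=; rewrite leNgt lt /= mul0r addr0. Qed.

Let exceed e m j := [set t | e < `|stopped_sum e m j t|].

Let measurable_exceed e m j : measurable (exceed e m j).
Proof.
have aB : adapted (m + j) (fun t => e < `|stopped_sum e m j t|).
  by move=> t t' tt'; rewrite (@adapted_stopped_sum e m j _ _ tt').
have := measurable_adapted aB measurableT (I : measurable [set true]).
by rewrite setTI.
Qed.

Lemma measure_exceed_le e m j : 0 < e ->
  ((e ^+ 2)%:E * P (exceed e m j) <= \sum_(m <= k <oo) step_variance k)%E.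
Proof.
move=> e0.
apply: le_trans (nneseries_lim_ge (m + j) _); last by move=> *; exact: step_variance_ge0.
apply: le_trans (integral_stopped_sum_sqr e m j).
have mZ : measurable_fun setT (fun t => (stopped_sum e m j t ^+ 2)%:E).
  apply: (@measurable_adapted (m + j)) => t t' tt'.
  by rewrite (@adapted_stopped_sum e m j _ _ tt').
rewrite -integral_cst //.
apply: (@le_trans _ _ (\int[P]_(t in exceed e m j) (stopped_sum e m j t ^+ 2)%:E)%E).
  apply: ge0_le_integral => //.
  - by move=> t _; rewrite /= lee_fin sqr_ge0.
  - exact: measurable_funS mZ.
  move=> t /= et; rewrite lee_fin -[leRHS]real_normK ?num_real //.
  by rewrite lerXn2r ?nnegrE // ltW.
apply: ge0_subset_integral => //.
by move=> t _; rewrite lee_fin sqr_ge0.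
Qed.

(** A path that fails oscillates by more than [e] after every [m]. For each [m] this has probability
    at most a tail of the convergent variance series over [e ^+ 2]. *)
Lemma ae_weighted_noise_cauchy (e : R) : 0 < e ->
  {ae P, forall t, exists m, forall j,
    `|weighted_noise_sum (m + j) t - weighted_noise_sum m t| <= e}.
Proof.
move=> e0.
pose B m := \bigcup_j exceed e m j.
have mB m : measurable (B m) by exact: bigcupT_measurable.
pose N := \bigcap_m B m.
have mN : measurable N by exact: bigcapT_measurable.
have NB m : N `<=` B m by move=> t; apply.
have PB m : ((e ^+ 2)%:E * P (B m) <= \sum_(m <= k <oo) step_variance k)%E.
  (* Freezing makes the events increase in [j], so the bound passes to their union. *)
  have nd : nondecreasing_seq (exceed e m).
    apply/nondecreasing_seqP => j; apply/subsetPset => t.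
    exact: stopped_sum_absorbed.
  have cvP : P \o exceed e m @ \oo --> P (B m).
    exact: (nondecreasing_cvg_mu (measurable_exceed e m) (mB m) nd).
  apply: (cvge_to_le (cvgeZl (isT : (e ^+ 2)%:E \is a fin_num) cvP)).
  apply: nearW => j.
  exact: measure_exceed_le.
have PN : ((e ^+ 2)%:E * P N <= 0)%E.
  have fin : (\sum_(0 <= k <oo) step_variance k < +oo)%E.
    apply: le_lt_trans (ltry (3 * (alpha * (1 - alpha) + sg2))).
    apply: lime_le; first by apply: is_cvg_nneseries => k _ _; exact: step_variance_ge0.
    by apply: nearW => n; exact: step_variance_sum.
  have tail := nneseries_tail_cvg fin (fun k _ => step_variance_ge0 k).
  apply: (cvge_to_ge tail); apply: nearW => m.
  apply: le_trans (PB m); apply: lee_wpmul2l.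
    by rewrite lee_fin sqr_ge0.
  by rewrite le_measure ?inE.
exists N; split => //.
  apply/eqP; rewrite -measure_le0 -(@lee_pmul2l _ (e ^+ 2)%:E) // ?lte_fin ?exprn_gt0 //.
  by rewrite mule0.
move=> t /= nt m _; apply: contrapT => nBt; apply: nt; exists m => j.
rewrite leNgt; apply/negP => /(stopped_sum_exceeds (ltW e0)) ?.
by apply: nBt; exists j.
Qed.

(** For each [m], all of the first [n] innovations after time [m] vanish with probability [p ^+ n],
    which tends to 0. *)
Lemma ae_eps_infinitely_often :
  (forall k, (0 < k)%N -> P (eps k @^-1` [set 0%N]) = P (eps 1%N @^-1` [set 0%N])) ->
  (P (eps 1%N @^-1` [set 0%N]) < 1)%E ->
  {ae P, forall t, forall m, exists2 k, (m < k)%N & (0 < eps k t)%N}.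
Proof.
move=> idE p1; apply: ae_foralln => m.
have iT := indep_event_setT.
pose l n : seq inar_index := [seq inr (inl (m + i).+1) | i <- iota 0 n].
have al n : all inar_valid (l n) by apply/allP => _ /mapP[i _ ->].
have ul n : uniq (l n) by rewrite map_inj_uniq ?iota_uniq // => i j [] /addnI.
pose A n := joint_event X (l n) (fun=> 0%N).
have mA n : measurable (A n) by case: iT => _ mX _; exact: measurable_joint_event mX (al n).
pose p := fine (P (eps 1%N @^-1` [set 0%N])).
have mE : measurable (eps 1%N @^-1` [set 0%N]).
  by case: iT => _ /(_ (inr (inl 1%N)) 0%N isT).
have pE : P (eps 1%N @^-1` [set 0%N]) = p%:E by rewrite fineK // fin_num_measure.
have PA n : P (A n) = (p ^+ n)%:E.
  case: iT => _ _ /(_ (l n) (fun=> 0%N) (ul n) (al n)).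
  rewrite setTI [X in (X * _)%E](probability_setT P) mul1e => ->.
  rewrite big_map (eq_bigr (fun=> p%:E)); last by move=> i _; rewrite /= idE.
  elim: n => [|n IH]; first by rewrite big_nil.
  by rewrite -addn1 iotaD big_cat IH /= big_cons big_nil mule1 -EFinM addn1 exprSr.
pose N := \bigcap_n A n.
have mN : measurable N by exact: bigcapT_measurable.
exists N; split => //.
  apply/eqP; rewrite -measure_le0.
  have p0 : 0 <= p by rewrite fine_ge0.
  have pp : `|p| < 1 by rewrite ger0_norm // -lte_fin -pE.
  have cvp : (fun n => (p ^+ n)%:E) @ \oo --> (0%:E : \bar R).
    by apply: cvg_EFin; [exact: nearW|exact: cvg_expr].
  apply: (cvge_to_ge cvp); apply: nearW => n; rewrite -PA.
  by rewrite le_measure ?inE // => t; apply.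
move=> t /= nt n _ i /mapP[k _ ->] /=; apply/eqP; rewrite eqn0Ngt; apply/negP => ek.
by apply: nt; exists (m + k).+1 => //; rewrite ltnS leq_addr.
Qed.

End inar.

(** * The conditional least squares estimators *)

Section least_squares.
Context {R : realType}.
Variables (mu : R) (s : nat).

(** Completing the square in [a], with vertex [alpha_tilde]; the separate square of time [s]
    vanishes at the estimators. *)
Lemma Qn_excess n (y : nat -> R) a th :
  \sum_(1 <= k < n.+1 | k != s) y k.-1 ^+ 2 != 0 ->
  Qn mu s n y a th - Qn mu s n y (alpha_tilde mu s n y) (theta_tilde mu s n y) =
  (a - alpha_tilde mu s n y) ^+ 2 * (\sum_(1 <= k < n.+1 | k != s) y k.-1 ^+ 2) +
  (y s - a * y s.-1 - mu - th) ^+ 2.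
Proof.
move=> D0.
have expand b : \sum_(1 <= k < n.+1 | k != s) (y k - b * y k.-1 - mu) ^+ 2 =
    \sum_(1 <= k < n.+1 | k != s) (y k - mu) ^+ 2
    - 2 * b * \sum_(1 <= k < n.+1 | k != s) (y k - mu) * y k.-1
    + b ^+ 2 * \sum_(1 <= k < n.+1 | k != s) y k.-1 ^+ 2.
  by rewrite !mulr_sumr -sumrB -big_split; apply: eq_bigr => k _ /=; ring.
rewrite /Qn !expand.
have -> : \sum_(1 <= k < n.+1 | k != s) (y k - mu) * y k.-1 =
    alpha_tilde mu s n y * \sum_(1 <= k < n.+1 | k != s) y k.-1 ^+ 2.
  by rewrite divfK.
by rewrite /theta_tilde; ring.
Qed.

Lemma Qn_unique_minimizer n (y : nat -> R) a th :
  0 < \sum_(1 <= k < n.+1 | k != s) y k.-1 ^+ 2 ->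
  (a, th) <> (alpha_tilde mu s n y, theta_tilde mu s n y) ->
  Qn mu s n y (alpha_tilde mu s n y) (theta_tilde mu s n y) < Qn mu s n y a th.
Proof.
move=> D0 ath; rewrite -subr_gt0 Qn_excess ?gt_eqF //.
have [aE|aN] := eqVneq a (alpha_tilde mu s n y).
  rewrite aE subrr expr0n mul0r add0r exprn_even_gt0 //= subr_eq0.
  by apply/eqP => thE; apply: ath; rewrite aE -thE.
apply: ltr_wpDr; first exact: sqr_ge0.
by rewrite mulr_gt0 // exprn_even_gt0 //= subr_eq0.
Qed.

Variable y : nat -> nat.

Lemma sum_sqr_design n :
  \sum_(1 <= k < n.+1 | k != s) ((y k.-1)%:R : R) ^+ 2 = (design s y n)%:R.
Proof.
by rewrite big_add1 natr_sum; apply: eq_bigr => k _; rewrite natrX.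
Qed.

(** This puts the estimation error in the form of Kronecker's lemma: multiplying [weight] by the
    design gives back [y k]. *)
Lemma alpha_tilde_error n a (z : nat -> R) :
  (forall k, k.+1 != s -> z k = (y k.+1)%:R - a * (y k)%:R - mu) ->
  design s y n != 0%N ->
  alpha_tilde mu s n (fun k => (y k)%:R) =
  a + (\sum_(0 <= k < n) (design s y k.+1)%:R * (weight s y k * z k)) / (design s y n)%:R.
Proof.
move=> zE D0.
rewrite /alpha_tilde sum_sqr_design.
have -> : \sum_(1 <= k < n.+1 | k != s) ((y k)%:R - mu) * (y k.-1)%:R =
    a * (design s y n)%:R +
    \sum_(0 <= k < n) (design s y k.+1)%:R * (weight s y k * z k).
  rewrite -sum_sqr_design !big_add1 /= mulr_sumr.
  rewrite [X in _ + X](eq_bigr (fun k => if k.+1 != s then (y k)%:R * z k else 0)).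
    rewrite -big_mkcond -big_split /=.
    by apply: eq_bigr => k /zE ->; ring.
  by move=> k _; rewrite mulrA weight_design; case: ifP => // _; rewrite mul0r.
by rewrite mulrDl mulfK // pnatr_eq0.
Qed.

Lemma design_unbounded :
  (forall m, exists2 k, (m < k)%N & (0 < y k)%N) ->
  forall B, exists n, (B <= design s y n)%N.
Proof.
move=> yio; elim=> [|B [n Bn]]; first by exists 0%N.
(* Beyond [s] no increment of the design is skipped, so a positive [y k] adds at least 1. *)
have [k] := yio (maxn n s); rewrite gtn_max => /andP[nk sk] yk.
exists k.+1; rewrite designS ifT; last by rewrite gtn_eqF // ltnS ltnW.
rewrite -addn1 leq_add ?expn_gt0 ?yk //.
exact: leq_trans Bn (design_nondecreasing _ _ (ltnW nk)).
Qed.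

End least_squares.

(** * Unique minimizer and strong consistency *)

Theorem theorem4p2p1 (d : measure_display) (T : measurableType d) (R : realType)
  (P : probability T R)
  (alpha : R) (Y0 : T -> nat) (eps : nat -> T -> nat) (xi : nat -> nat -> T -> nat)
  (mu : R) (s theta : nat) :
  0 < alpha < 1 ->
  (0 < s)%N -> (0 < theta)%N ->
  (* all of Y_0, (eps_k)_{k>=1}, (xi_{k,j})_{k,j>=1} are mutually independent *)
  mutually_independent_nat P inar_valid (inar_family Y0 eps xi) ->
  (* eps_k identically distributed *)
  (forall k v, (0 < k)%N -> P (eps k @^-1` [set v]) = P (eps 1%N @^-1` [set v])) ->
  (* E eps_1^2 < oo, P(eps_1 <> 0) > 0, mu = E eps_1 *)
  P.-integrable setT (fun t => (((eps 1%N t)%:R : R) ^+ 2)%:E) ->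
  (0 < P [set t | eps 1%N t <> 0%N])%E ->
  (\int[P]_t ((eps 1%N t)%:R : R)%:E = mu%:E)%E ->
  (* xi_{k,j} Bernoulli(alpha) *)
  (forall k j, (0 < k)%N -> (0 < j)%N ->
     P (xi k j @^-1` [set 1%N]) = alpha%:E /\
     P (xi k j @^-1` [set 0%N]) = (1 - alpha)%:E) ->
  (* E Y_0^2 < oo *)
  P.-integrable setT (fun t => (((Y0 t)%:R : R) ^+ 2)%:E) ->
  {ae P, forall t,
    let Y := fun k => ((inarY Y0 eps xi s theta k t)%:R : R) in
    (exists n0, forall n, (n0 <= n)%N -> (s <= n)%N ->
       forall a th, (a, th) <> (alpha_tilde mu s n Y, theta_tilde mu s n Y) ->
         Qn mu s n Y (alpha_tilde mu s n Y) (theta_tilde mu s n Y) < Qn mu s n Y a th)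
    /\ (fun n => alpha_tilde mu s n Y) @ \oo --> alpha
    /\ (fun n => theta_tilde mu s n Y) @ \oo --> (Y s - alpha * Y s.-1 - mu)}.
Proof.
move=> alpha01 s0 theta0 indepX idE iE2 PE mE bern iY2.
pose X := inar_family Y0 eps xi.
have mX i v : inar_valid i -> measurable (X i @^-1` [set v]).
  by case: indepX => + _; apply.
pose sg2 := fine (\int[P]_t (((eps 1%N t)%:R : R) ^+ 2)%:E) - mu ^+ 2.
have eps_moments k : (0 < k)%N -> centered_moments P X (inr (inl k)) mu sg2.
  move=> k0; apply: (@square_integrable_centered_moments _ _ _ P _ X (inr (inl 1%N))) => //.
    by move=> v; exact: mX.
  by move=> v; exact: idE.
have xi_moments k j : (0 < k)%N -> (0 < j)%N ->
    centered_moments P X (inr (inr (k, j))) alpha (alpha * (1 - alpha)).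
  move=> k0 j0; have [P1 P0] := bern k j k0 j0.
  by apply: bernoulli_centered_moments => // v; apply: mX; rewrite /= k0.
have p1 : (P (eps 1%N @^-1` [set 0%N]) < 1)%E.
  have m0 : measurable (eps 1%N @^-1` [set 0%N]) by exact: (mX (inr (inl 1%N))).
  move: PE; rewrite (_ : [set t | _] = ~` (eps 1%N @^-1` [set 0%N])) //.
  by rewrite probability_setC // sube_gt0.
(* Countably many tolerances are used, so that one null set serves them all. *)
have cauchy : {ae P, forall t, forall p, exists m, forall j,
    `|weighted_noise_sum alpha Y0 eps xi mu s theta (m + j) t
      - weighted_noise_sum alpha Y0 eps xi mu s theta m t| <= (p.+1%:R)^-1}.
  apply: ae_foralln => p.
  have p0 : 0 < p.+1%:R^-1 :> R by rewrite invr_gt0.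
  exact: (ae_weighted_noise_cauchy s theta indepX eps_moments xi_moments p0).
have io := ae_eps_infinitely_often indepX (fun k => idE k 0%N) p1.
apply: filterS2 cauchy io => t cauchy io.
pose y k := inarY Y0 eps xi s theta k t.
pose Y : nat -> R := fun k => (y k)%:R.
rewrite -/Y.
have D_unbounded := @design_unbounded s y.
(* At each positive time the process is at least its innovation. *)
have y_io m : exists2 k, (m < k)%N & (0 < y k)%N.
  have [[//|k] mk ek] := io m; exists k.+1 => //.
  by rewrite /y /=; apply: leq_trans ek _; rewrite -addnA addnCA leq_addr.
have {}D_unbounded := D_unbounded y_io.
have [n0 Dn0] := D_unbounded 1%N.
have D_gt0 n : (n0 <= n)%N -> (0 < design s y n)%N.
  by move=> /(design_nondecreasing s y); exact: leq_trans.
have alphaE n : (n0 <= n)%N -> alpha_tilde mu s n Y = alpha +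
    (\sum_(0 <= k < n) (design s y k.+1)%:R *
      (weight s y k * inar_noise alpha Y0 eps xi mu s theta k t)) / (design s y n)%:R.
  move=> /D_gt0 Dn; apply: alpha_tilde_error; last by rewrite -lt0n.
  by move=> k ks; rewrite /inar_noise (negbTE ks) subr0.
have alpha_cvg : (fun n => alpha_tilde mu s n Y) @ \oo --> alpha.
  rewrite -[X in _ --> X]addr0.
  apply: (@cvg_trans _ ((fun n => alpha +
    (\sum_(0 <= k < n) (design s y k.+1)%:R *
      (weight s y k * inar_noise alpha Y0 eps xi mu s theta k t)) / (design s y n)%:R) @ \oo)).
    by apply: near_eq_cvg; exists n0 => // n /= /alphaE ->.
  apply: cvgD; first exact: cvg_cst.
  apply: (@kronecker R (fun n => (design s y n)%:R)).
  - by move=> n.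
  - by move=> m n mn; rewrite ler_nat; exact: design_nondecreasing.
  - move=> B; have [n Bn] := D_unbounded (Num.truncn B).+1; exists n.
    by apply: ltW; apply: lt_le_trans (truncnS_gt _) _; rewrite ler_nat.
  move=> e e0; have [p pe] : exists p : nat, p.+1%:R^-1 <= e.
    exists (Num.truncn e^-1); rewrite -[leRHS]invrK lef_pV2 ?posrE ?invr_gt0 //.
    by rewrite ltW // truncnS_gt.
  have [m Hm] := cauchy p; exists m => j; exact: le_trans (Hm j) pe.
split; last split => //.
  exists n0 => n n0n _ a th; apply: Qn_unique_minimizer.
  by rewrite sum_sqr_design ltr0n D_gt0.
rewrite /theta_tilde; apply: cvgB; last exact: cvg_cst.
apply: cvgB; first exact: cvg_cst.
by apply: cvgM => //; exact: cvg_cst.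
Qed.
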